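(* Let $m\ge n$, let $F=(F_1,\dots,F_m)^T:\mathbb{R}^n\to\mathbb{R}^m$ be twice continuously differentiable with Jacobian $J(x)\in\mathbb{R}^{m\times n}$, and let $f(x)=\frac12\|F(x)\|^2$. Let $x_0\in\mathbb{R}^n$ and suppose that: (1) the level set $\mathcal{L}=\{x\in\mathbb{R}^n: f(x)\le f(x_0)\}$ is bounded; (2) (a) $f$ is continuously differentiable in some neighborhood $\mathcal{N}$ of $\mathcal{L}$, and (b) the Jacobian $J$ is Lipschitz continuous on $\mathcal{L}$. Let $\{x_k\}_{k\ge 0}$ be an infinite sequence of iterates generated from $x_0$ by the SSGM algorithm (with either of its two choices of stepsize), and let $g_k=\nabla f(x_k)$. Then $x_k\in\mathcal{L}$ for all $k$ and $$\liminf_{k\to\infty}\|g_k\|=0.$$ Moreover, if $\eta_{max}<1$, then $$\lim_{k\to\infty}\|g_k\|=0.$$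
   Context: $\|\cdot\|$ is the Euclidean norm. Write $f_k=f(x_k)$, $g_k=\nabla f(x_k)=J(x_k)^TF(x_k)$, $F_k=F(x_k)$, $J_k=J(x_k)$. For $k\ge1$ set $s_{k-1}=x_k-x_{k-1}$ and $$z_{k-1}=J_k^T(F_k-F_{k-1})+(J_k-J_{k-1})^TF_k .$$ SSGM algorithm (structured two-point stepsize gradient method). Parameters: $\lambda_{max}\ge\lambda_{min}>0$, $\gamma\in(0,1)$, $0\le\eta_{min}\le\eta_{max}\le1$, $\beta>0$. Initialization: $x_0\in\mathbb{R}^n$, $C_0=f(x_0)$, $Q_0=1$, $\lambda_0=\alpha_0=1$. For $k=0,1,2,\dots$: - Stop if $g_k=0$. - Set $d_k=-\lambda_kg_k$. - Nonmonotone line search: start with $t=1$. If $f(x_k+td_k)\le C_k+\gamma t\,g_k^Td_k$, set $t_k=t$ and $x_{k+1}=x_k+t_kd_k$. Otherwise replace $t$ by the value given by quadratic interpolation, i.e. the minimizer $-t^2g_k^Td_k/\bigl(2(f(x_k+td_k)-f_k-t\,g_k^Td_k)\bigr)$ of the quadratic polynomial interpolating $\phi(0),\phi'(0),\phi(t)$ where $\phi(t)=f(x_k+td_k)$, and test again. As this is a backtracking procedure, each new trial value is understood to be smaller than the rejected one, and the search is understood to end after finitely many trials. - Compute the next stepsize $\lambda_{k+1}=\min\{\max\{\alpha_{k+1},\lambda_{min}\},\lambda_{max}\}$, where, for $j=k+1\ge1$, $\alpha_j$ is given by one fixed choice among (first choice) $\alpha_j=\dfrac{s_{j-1}^Ts_{j-1}}{s_{j-1}^Tz_{j-1}}$,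 or (second choice) $\alpha_j=\dfrac{s_{j-1}^Tz_{j-1}}{z_{j-1}^Tz_{j-1}}$, except that, if $s_{j-1}^Tz_{j-1}\le0$, the term $s_{j-1}^Tz_{j-1}$ in that formula (the denominator in the first choice, the numerator in the second) is replaced by $$\tau_j=\max\{\beta\alpha_{j-1},\ s_{j-1}^Tz_{j-1}+\|s_{j-1}\|\,\|z_{j-1}\|\}.$$ - Choose $\eta_k\in[\eta_{min},\eta_{max}]$ and set $Q_{k+1}=\eta_kQ_k+1$, $C_{k+1}=\dfrac{\eta_kQ_kC_k+f(x_{k+1})}{Q_{k+1}}$. The generated sequence is understood to come from a run in which all the quantities above are defined (in particular no division by zero occurs). *)

(* Defs.v *)
(* MathComp-Analysis.  Vectors of R^n are row vectors, so the product A v of a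
   matrix A : 'M_(m, n) with a vector v is written v *m A^T, and A^T w is
   written w *m A. *)
From HB Require Import structures.
From mathcomp Require Import all_boot all_order all_algebra.
From mathcomp Require Import all_classical all_reals all_analysis.

Set Implicit Arguments.
Unset Strict Implicit.
Unset Printing Implicit Defensive.

Import Order.TTheory GRing.Theory Num.Theory.
Import numFieldNormedType.Exports.

Local Open Scope classical_set_scope.
Local Open Scope ring_scope.

Definition dot (R : realType) (n : nat) (u v : 'rV[R]_n) : R :=
  (u *m v^T) 0 0.

(* The library's norm `|v| on 'rV_n is the max norm. *)
Definition enorm (R : realType) (n : nat) (v : 'rV[R]_n) : R :=
  Num.sqrt (dot v v).

Definition opnorm (R : realType) (m n : nat) (A : 'M[R]_(m, n)) : R :=
  sup [set enorm (v *m A^T) | v in [set v : 'rV[R]_n | enorm v <= 1]].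

Definition grad (R : realType) (n : nat) (f : 'rV[R]_n -> R) (x : 'rV[R]_n) :
    'rV[R]_n :=
  \row_j 'D_(delta_mx 0 j) f x.

(* The library's jacobian acts by right multiplication on row vectors, so its
   entry (j, i) is the partial derivative of F_i along the j-th coordinate;
   the usual m x n Jacobian matrix is its transpose. *)
Definition Jac (R : realType) (m n : nat) (F : 'rV[R]_n -> 'rV[R]_m)
    (x : 'rV[R]_n) : 'M[R]_(m, n) :=
  (jacobian F x)^T.

(* To be used with U open. *)
Definition C1_on (R : realType) (n : nat) (U : set 'rV[R]_n)
    (f : 'rV[R]_n -> R) : Prop :=
  forall x, U x -> differentiable f x /\ {for x, continuous (grad f)}.

Definition C2 (R : realType) (m n : nat) (F : 'rV[R]_n -> 'rV[R]_m) : Prop :=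
  forall i : 'I_m,
    C1_on setT (fun x => F x 0 i) /\
    forall j : 'I_n, C1_on setT (fun x => grad (fun y => F y 0 i) x 0 j).

Definition objective (R : realType) (m n : nat) (F : 'rV[R]_n -> 'rV[R]_m)
    (x : 'rV[R]_n) : R :=
  2^-1 * enorm (F x) ^+ 2.

Definition level_set (R : realType) (n : nat) (f : 'rV[R]_n -> R)
    (x0 : 'rV[R]_n) : set 'rV[R]_n :=
  [set x | f x <= f x0].

Definition step (R : realType) (n : nat) (x : nat -> 'rV[R]_n) (k : nat) :
    'rV[R]_n :=
  x k.+1 - x k.

Definition zvec (R : realType) (m n : nat) (F : 'rV[R]_n -> 'rV[R]_m)
    (x : nat -> 'rV[R]_n) (k : nat) : 'rV[R]_n :=
  (F (x k.+1) - F (x k)) *m Jac F (x k.+1)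
  + F (x k.+1) *m (Jac F (x k.+1) - Jac F (x k)).

Definition acceptable (R : realType) (n : nat) (f : 'rV[R]_n -> R)
    (x d : 'rV[R]_n) (C gamma t : R) : bool :=
  f (x + t *: d) <= C + gamma * t * dot (grad f x) d.

Definition interp_den (R : realType) (n : nat) (f : 'rV[R]_n -> R)
    (x d : 'rV[R]_n) (t : R) : R :=
  2 * (f (x + t *: d) - f x - t * dot (grad f x) d).

Definition interp (R : realType) (n : nat) (f : 'rV[R]_n -> R)
    (x d : 'rV[R]_n) (t : R) : R :=
  - (t ^+ 2 * dot (grad f x) d) / interp_den f x d t.

(* [line_search f x d C gamma t t']: the backtracking loop, entered with trial
   value t, ends after finitely many trials with accepted value t'. *)
Inductive line_search (R : realType) (n : nat) (f : 'rV[R]_n -> R)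
    (x d : 'rV[R]_n) (C gamma : R) : R -> R -> Prop :=
| LS_accept (t : R) :
    acceptable f x d C gamma t -> line_search f x d C gamma t t
| LS_reject (t t' : R) :
    ~~ acceptable f x d C gamma t ->
    interp_den f x d t != 0 ->
    interp f x d t < t ->
    line_search f x d C gamma (interp f x d t) t' ->
    line_search f x d C gamma t t'.

Inductive stepsize_choice : Set := FirstChoice | SecondChoice.

(* The safeguarded value of s^T z; [a] is the previous alpha. *)
Definition safe_sz (R : realType) (n : nat) (beta a : R) (s z : 'rV[R]_n) : R :=
  if dot s z <= 0 then Num.max (beta * a) (dot s z + enorm s * enorm z)
  else dot s z.

Definition alpha_num (R : realType) (n : nat) (c : stepsize_choice)
    (beta a : R) (s z : 'rV[R]_n) : R :=
  match c with
  | FirstChoice => dot s s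
  | SecondChoice => safe_sz beta a s z
  end.

Definition alpha_den (R : realType) (n : nat) (c : stepsize_choice)
    (beta a : R) (s z : 'rV[R]_n) : R :=
  match c with
  | FirstChoice => safe_sz beta a s z
  | SecondChoice => dot z z
  end.

(* A non-terminating run from x0.  The conditions [_ != 0] say that the run
   never stops and that the divisions performed are defined. *)
Record SSGM_run (R : realType) (m n : nat) (F : 'rV[R]_n -> 'rV[R]_m)
    (c : stepsize_choice)
    (lambda_min lambda_max gamma eta_min eta_max beta : R) (x0 : 'rV[R]_n)
    (x : nat -> 'rV[R]_n) (t lambda alpha eta C Q : nat -> R) : Prop := {
  run_x0 : x 0%N = x0;
  run_C0 : C 0%N = objective F x0;
  run_Q0 : Q 0%N = 1;
  run_lambda0 : lambda 0%N = 1;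
  run_alpha0 : alpha 0%N = 1;
  run_nonstop : forall k, grad (objective F) (x k) != 0;
  run_search : forall k,
    line_search (objective F) (x k) (- (lambda k *: grad (objective F) (x k)))
      (C k) gamma 1 (t k);
  run_x : forall k,
    x k.+1 = x k + t k *: - (lambda k *: grad (objective F) (x k));
  run_alpha_def : forall k,
    alpha_den c beta (alpha k) (step x k) (zvec F x k) != 0;
  run_alpha : forall k,
    alpha k.+1 = alpha_num c beta (alpha k) (step x k) (zvec F x k)
                 / alpha_den c beta (alpha k) (step x k) (zvec F x k);
  run_lambda : forall k,
    lambda k.+1 = Num.min (Num.max (alpha k.+1) lambda_min) lambda_max;
  run_eta : forall k, eta_min <= eta k <= eta_max;
  run_Q : forall k, Q k.+1 = eta k * Q k + 1;
  run_Q_def : forall k, Q k.+1 != 0;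
  run_C : forall k,
    C k.+1 = (eta k * Q k * C k + objective F (x k.+1)) / Q k.+1
}.

(* Main.v *)
Require Import Defs.
From HB Require Import structures.
From mathcomp Require Import all_boot all_order all_algebra.
From mathcomp Require Import all_classical all_reals all_analysis.
From mathcomp Require Import ring lra.

Set Implicit Arguments.
Unset Strict Implicit.
Unset Printing Implicit Defensive.

Import Order.TTheory GRing.Theory Num.Theory.
Import numFieldNormedType.Exports.
Local Open Scope classical_set_scope.
Local Open Scope ring_scope.

(** Fix an iterate x in the level set, and let d = - lambda g be its search
    direction.  The whole argument rests on a lower bound on the accepted step
    that is uniform in k.

    Since the level set is bounded and lambda_k <= max 1 lambda_max, every trial
    point x + t d with t <= 1 lies in one fixed ball.  On this ball the second
    partial derivatives of the objective are bounded, whence the quadratic upper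
    bound [descent_ball]
      f (x + t d) - f x - t <g, d> <= K t^2 <d, d>.
    A rejected trial t violates f (x + t d) <= C + gamma t <g, d>; as f x <= C,
    gamma < 1 and <g, d> < 0, the denominator of the interpolation formula is
    positive.  By the quadratic bound it is at most 2 K t^2 <d, d>, hence the
    interpolated value is at least - <g, d> / (2 K <d, d>) = 1 / (2 K lambda),
    whatever t was ([line_search_bound]).  No accumulation over repeated
    rejections occurs, so the accepted step is at least min 1 (1 / (2 K lambda)), which is bounded
    away from 0 ([accepted_step_lower_bound]).

    As lambda_k >= min 1 lambda_min, acceptance gives
    f_{k+1} <= C_k - delta |g_k|^2 for a fixed delta > 0, and averaging turns
    this into
      f_{k+1} <= C_{k+1} <= C_k - delta |g_k|^2 / Q_{k+1}
    ([nonmonotone_average_bounds]).  In particular f_k <= C_k <= f x0, which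
    keeps the iterates in the level set.  The C_k are nonincreasing and
    nonnegative, so the decreases are summable.  Always Q_k <= k + 1, and the
    divergence of the harmonic series forbids |g_k|^2 to stay away from 0
    ([harmonic_decrease_small]); if eta_max < 1, then Q_k <= 1 / (1 - eta_max)
    and |g_k|^2 tends to 0 ([bounded_weight_decrease_cvg0]).

    The values alpha_k enter only through the clamping of lambda_k, so both
    stepsize choices are treated at once. *)

(** * First and second derivatives of the objective *)

Lemma deriveE_dot (R : realType) (n : nat) (f : 'rV[R]_n -> R) (x v : 'rV[R]_n) :
  differentiable f x -> 'D_v f x = dot (grad f x) v.
Proof.
move=> df; rewrite deriveE// [in LHS](row_sum_delta v) linear_sum /=.
rewrite /dot mxE; apply: eq_bigr => j _.
by rewrite linearZ /= !mxE deriveE// mulrC.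
Qed.

(** The one-variable mean value theorem applied to s |-> f (x + s v). *)
Lemma mean_value_line (R : realType) (n : nat) (f : 'rV[R]_n -> R)
    (x v : 'rV[R]_n) (t : R) :
  (forall y, differentiable f y) -> 0 <= t ->
  exists2 c, 0 <= c <= t &
    f (x + t *: v) - f x = t * dot (grad f (x + c *: v)) v.
Proof.
move=> df t0; pose h (s : R) := f (x + s *: v).
have dl s : is_diff s (fun s : R => x + s *: v) (fun s : R => s *: v).
  by apply: is_diff_eq; rewrite add0r.
have dh s : is_derive s (1 : R) h (dot (grad f (x + s *: v)) v).
  have dfs : is_diff (x + s *: v) f ('d f (x + s *: v)) by exact: differentiableP.
  have hs := @is_diff_comp _ _ _ _ _ _ _ _ _ (dl s) dfs.
  apply: DeriveDef; first by apply: diff_derivable; have [] := hs.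
  rewrite deriveE; last by have [] := hs.
  by rewrite diff_val /= scale1r -deriveE_dot// deriveE.
have ch : {within `[0, t], continuous h}.
  apply: continuous_subspaceT => s.
  apply: differentiable_continuous; apply/derivable1_diffP.
  by have [] := dh s.
have [c] := MVT_segment t0 (fun s _ => dh s) ch.
rewrite in_itv /= => c01; rewrite /h scale0r addr0 subr0 mulrC => ->.
  by exists c.
Qed.

(** [C1_on setT] with the continuity of the gradient read coordinate by
    coordinate, so that closure under sums and products is a statement about
    real-valued functions. *)
Definition coordwise_C1 (R : realType) (n : nat) (f : 'rV[R]_n -> R) : Prop :=
  (forall x, differentiable f x) /\
  forall j, continuous (fun x => grad f x 0 j).

Lemma C1_onT (R : realType) (n : nat) (f : 'rV[R]_n -> R) :
  C1_on setT f -> coordwise_C1 f.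
Proof.
move=> hf; split=> [x|j x]; first by have [] := hf x I.
have [_ cf] := hf x I.
by apply: (@continuous_comp _ _ _ (grad f) (fun M : 'rV_n => M 0 j));
  [exact: cf|exact: coord_continuous].
Qed.

Lemma gradM (R : realType) (n : nat) (f g : 'rV[R]_n -> R) x j :
  differentiable f x -> differentiable g x ->
  grad (fun y => f y * g y) x 0 j = f x * grad g x 0 j + g x * grad f x 0 j.
Proof.
by move=> df dg; rewrite !mxE; rewrite deriveM; [|exact: diff_derivable..].
Qed.

Lemma grad_sum (R : realType) (n m : nat) (f : 'I_m -> 'rV[R]_n -> R) x j :
  (forall i, differentiable (f i) x) ->
  grad (fun y => \sum_i f i y) x 0 j = \sum_i grad (f i) x 0 j.
Proof.
move=> df; rewrite mxE -fct_sumE derive_sum; last first.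
  by move=> i; exact: diff_derivable.
by apply: eq_bigr => i _; rewrite mxE.
Qed.

Lemma coordwise_C1M (R : realType) (n : nat) (f g : 'rV[R]_n -> R) :
  coordwise_C1 f -> coordwise_C1 g -> coordwise_C1 (fun x => f x * g x).
Proof.
move=> [df cf] [dg cg]; split=> [x|j]; first exact: differentiableM.
rewrite (_ : (fun x => grad _ x 0 j) =
  fun x => f x * grad g x 0 j + g x * grad f x 0 j).
  move=> x.
  apply: (@continuousD _ _ _ (fun x => f x * grad g x 0 j)
                             (fun x => g x * grad f x 0 j)).
    by apply: continuousM; [exact: differentiable_continuous|exact: cg].
  by apply: continuousM; [exact: differentiable_continuous|exact: cf].
by apply/funext => x; rewrite gradM.
Qed.

Lemma coordwise_C1_sum (R : realType) (n m : nat) (f : 'I_m -> 'rV[R]_n -> R) :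
  (forall i, coordwise_C1 (f i)) -> coordwise_C1 (fun x => \sum_i f i x).
Proof.
move=> hf; split=> [x|j].
  by rewrite -fct_sumE; apply: differentiable_sum => i; have [] := hf i.
rewrite (_ : (fun x => grad _ x 0 j) = fun x => \sum_i grad (f i) x 0 j).
  by apply: continuous_big => [|i _]; [exact: add_continuous|have [_] := hf i].
by apply/funext => x; rewrite grad_sum// => i; have [] := hf i.
Qed.

Lemma coordwise_C1Z (R : realType) (n : nat) (k : R) (f : 'rV[R]_n -> R) :
  coordwise_C1 f -> coordwise_C1 (fun x => k * f x).
Proof.
move=> hf; apply: coordwise_C1M => //; split=> [x|j].
  exact: differentiable_cst.
rewrite (_ : (fun x => grad _ x 0 j) = cst 0); first exact: cst_continuous.
by apply/funext => x; rewrite mxE derive_cst.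
Qed.

Lemma objectiveE (R : realType) (m n : nat) (F : 'rV[R]_n -> 'rV[R]_m) :
  objective F = fun x => 2^-1 * \sum_i F x 0 i * F x 0 i.
Proof.
apply/funext => x; rewrite /objective /enorm sqr_sqrtr /dot mxE.
  by congr (_ * _); apply: eq_bigr => i _; rewrite mxE.
by apply: sumr_ge0 => i _; rewrite mxE -expr2 sqr_ge0.
Qed.

Lemma objective_coordwise_C1 (R : realType) (m n : nat) (F : 'rV[R]_n -> 'rV[R]_m) :
  C2 F -> coordwise_C1 (objective F).
Proof.
move=> hF; rewrite objectiveE; apply: coordwise_C1Z.
apply: coordwise_C1_sum => i; have [/C1_onT hi _] := hF i.
exact: coordwise_C1M.
Qed.

Lemma grad_objectiveE (R : realType) (m n : nat) (F : 'rV[R]_n -> 'rV[R]_m) x j :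
  C2 F -> grad (objective F) x 0 j =
          \sum_i F x 0 i * grad (fun y => F y 0 i) x 0 j.
Proof.
move=> hF.
have dF i : differentiable (fun y => F y 0 i) x by have [/(_ x I)[]] := hF i.
rewrite objectiveE gradM ?grad_sum//.
- rewrite [grad (fun _ => _) _ _ _]mxE derive_cst mulr0 addr0 mulr_sumr.
  by apply: eq_bigr => i _; rewrite gradM//; field.
- by move=> i; exact: differentiableM.
- by rewrite -fct_sumE; apply: differentiable_sum => i; exact: differentiableM.
Qed.

(** A C2 map F has a C2 objective: the j-th partial derivative of the objective
    is the sum of the products F_i * d_j F_i of C1 functions. *)
Lemma grad_objective_coordwise_C1 (R : realType) (m n : nat)
    (F : 'rV[R]_n -> 'rV[R]_m) (j : 'I_n) :
  C2 F -> coordwise_C1 (fun x => grad (objective F) x 0 j).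
Proof.
move=> hF; under eq_fun do rewrite grad_objectiveE//.
apply: coordwise_C1_sum => i; have [/C1_onT hi /(_ j)/C1_onT hij] := hF i.
exact: coordwise_C1M.
Qed.

(** * The quadratic upper bound on a ball *)

(** Balls of R^n are compact; the finite family is bounded by the sum of the
    individual bounds, and 1 is added to make the bound positive. *)
Lemma continuous_bounded_ball (R : realType) (n : nat) (I : finType)
    (p : I -> 'rV[R]_n -> R) (r : R) :
  (forall i, continuous (p i)) ->
  exists2 M, 0 < M & forall i x, `|x| <= r -> `|p i x| <= M.
Proof.
move=> cp; pose B := closed_ball_ Num.norm (0 : 'rV[R]_n) r.
have BE x : `|x| <= r -> B x by rewrite /B /closed_ball_ /= sub0r normrN.
have cB : compact B.
  apply: bounded_closed_compact; last exact: closed_closed_ball_.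
  exists r; split; first exact: num_real.
  move=> s rs x; rewrite /B /closed_ball_ /= sub0r normrN => xr.
  exact: le_trans xr (ltW rs).
have hM i : exists M, forall x, `|x| <= r -> `|p i x| <= M.
  have [M [_ hM]] :=
    compact_bounded (continuous_compact (continuous_subspaceT (cp i)) cB).
  exists (M + 1) => x /BE Bx; apply: (hM (M + 1)); first by rewrite ltrDl.
  by exists x.
have [M MP] := choice hM.
exists (1 + \sum_i `|M i|) => [|i x xr].
  by rewrite ltr_pwDl// sumr_ge0.
rewrite (le_trans (MP i x xr))// (le_trans (ler_norm _))//.
by rewrite (bigD1 i)//= addrCA lerDl addr_ge0// sumr_ge0.
Qed.

Lemma normr_rV_le (R : realType) (n : nat) (v : 'rV[R]_n) (M : R) :
  0 <= M -> (forall j, `|v 0 j| <= M) -> `|v| <= M.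
Proof.
move=> M0 hv; rewrite /Num.norm /= mx_normrE; apply: bigmax_le => // -[i j] _ /=.
by rewrite ord1.
Qed.

Lemma dot_ge0 (R : realType) (n : nat) (v : 'rV[R]_n) : 0 <= dot v v.
Proof. by rewrite /dot mxE sumr_ge0// => j _; rewrite mxE -expr2 sqr_ge0. Qed.

Lemma dot_gt0 (R : realType) (n : nat) (v : 'rV[R]_n) : v != 0 -> 0 < dot v v.
Proof.
move=> v0; rewrite lt0r dot_ge0 andbT; apply: contraNneq v0 => /eqP.
rewrite /dot mxE psumr_eq0; last by move=> j _; rewrite mxE -expr2 sqr_ge0.
move=> /allP v0; apply/eqP/rowP => j; rewrite mxE.
by have := v0 j (mem_index_enum _); rewrite !mxE -expr2 sqrf_eq0 => /eqP.
Qed.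

Lemma mul_coord_le_dot (R : realType) (n : nat) (v : 'rV[R]_n) (j l : 'I_n) :
  `|v 0 j| * `|v 0 l| <= dot v v.
Proof.
have sq i : `|v 0 i| ^+ 2 <= dot v v.
  rewrite /dot mxE (bigD1 i)//= mxE real_normK ?num_real// -expr2 lerDl sumr_ge0//.
  by move=> k _; rewrite mxE -expr2 sqr_ge0.
by have := sq j; have := sq l; have := sqr_ge0 (`|v 0 j| - `|v 0 l|); nra.
Qed.

(** Taylor's inequality with a Lipschitz gradient, obtained by two uses of the
    mean value theorem: one for f along the segment, one for each partial
    derivative of f.  The points reached lie on the segment, hence in the ball.
    The n^2 products |v_j| |v_l| are each at most <v, v>, whence the factor
    n^2. *)
Lemma descent_ball (R : realType) (n : nat) (f : 'rV[R]_n -> R) (r M : R) :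
  (forall x, differentiable f x) ->
  (forall j x, differentiable (fun y => grad f y 0 j) x) ->
  (forall j l x, `|x| <= r -> `|grad (fun y => grad f y 0 j) x 0 l| <= M) ->
  forall x v (t : R), 0 <= t -> `|x| <= r -> `|x + t *: v| <= r ->
  f (x + t *: v) - f x - t * dot (grad f x) v
    <= n%:R ^+ 2 * M * t ^+ 2 * dot v v.
Proof.
move=> df ddf hM x v t t0 xr xtr.
have segr c : 0 <= c <= t -> `|x + c *: v| <= r.
  move=> /andP[c0 ct]; have [t00|tn0] := eqVneq t 0.
    have c00 : c = 0 by lra.
    by rewrite c00 scale0r addr0.
  have -> : x + c *: v = (1 - c / t) *: x + (c / t) *: (x + t *: v).
    by rewrite scalerDr addrA -scalerDl subrK scale1r scalerA divfK.
  have u0 : 0 <= c / t by rewrite divr_ge0.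
  have u1 : c / t <= 1 by rewrite ler_pdivrMr ?mul1r// lt0r tn0.
  rewrite (le_trans (ler_normD _ _))// 2!normrZ.
  rewrite (ger0_norm u0) ger0_norm ?subr_ge0//.
  rewrite -[r](subrK (c / t * r)) -{1}[r]mul1r -mulrBl.
  by rewrite lerD// ler_wpM2l// subr_ge0.
have hdot (p q : 'rV[R]_n) : dot p q = \sum_j p 0 j * q 0 j.
  by rewrite /dot mxE; apply: eq_bigr => j _; rewrite mxE.
have [c ct ->] := mean_value_line x v df t0.
have /andP[c0 clet] := ct.
rewrite -mulrBr (hdot (grad f x)) (hdot (grad f _)) -sumrB.
apply: (@le_trans _ _ (t * \sum_(j < n) \sum_(l < n) (t * M * dot v v))).
  rewrite ler_wpM2l//; apply: ler_sum => j _.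
  have [b /andP[b0 bc] hb] := mean_value_line x v (ddf j) c0.
  have br : `|x + b *: v| <= r by rewrite segr// b0 (le_trans bc).
  rewrite -mulrBl hb hdot -[leLHS]mulrA mulr_suml mulr_sumr; apply: ler_sum => l _.
  rewrite (le_trans (ler_norm _))// !normrM (ger0_norm c0).
  have h1 := mul_coord_le_dot v j l.
  have h2 := hM j l _ br.
  rewrite -!mulrA ler_pM ?mulr_ge0// ler_pM ?mulr_ge0//.
  by rewrite mulrC.
by rewrite !sumr_const card_ord -mulr_natl -[_ *+ n]mulr_natl; lra.
Qed.

(** * The interpolating line search *)

(** Every interpolated value produced by a rejection is at least
    - <g, d> / (2 K <d, d>), independently of the rejected trial: the t^2 of the
    numerator cancels that of the quadratic upper bound on the denominator.  So
    the bound survives any number of rejections. *)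
Lemma line_search_bound (R : realType) (n : nat) (f : 'rV[R]_n -> R)
    (x d : 'rV[R]_n) (C gamma K : R) :
  f x <= C -> gamma < 1 -> 0 < K -> dot (grad f x) d < 0 -> 0 < dot d d ->
  (forall t, 0 <= t <= 1 ->
     f (x + t *: d) - f x - t * dot (grad f x) d <= K * t ^+ 2 * dot d d) ->
  forall t t', line_search f x d C gamma t t' -> 0 < t <= 1 ->
  [/\ acceptable f x d C gamma t', 0 < t' &
      Num.min t (- dot (grad f x) d / (2 * K * dot d d)) <= t'].
Proof.
move=> fC g1 K0 gd0 dd0 hK t t'.
elim=> {t t'} [t acc /andP[t0 t1]|t t' rej den0 itt _ IH /andP[t0 t1]].
  by split=> //; rewrite ge_min lexx.
set tau := _ / (2 * K * _) in IH *.
have den_gt0 : 0 < interp_den f x d t.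
  move: rej; rewrite /acceptable -ltNge /interp_den => rej.
  rewrite mulr_gt0//.
  have : 0 < (1 - gamma) * t * - dot (grad f x) d.
    by rewrite !mulr_gt0 ?subr_gt0 ?oppr_gt0.
  lra.
have den_le : interp_den f x d t <= 2 * K * t ^+ 2 * dot d d.
  have := hK t; rewrite (ltW t0) t1 /interp_den => /(_ isT); lra.
have tau_le : tau <= interp f x d t.
  rewrite /interp ler_pdivlMr//.
  have tau0 : 0 < tau by rewrite divr_gt0 ?oppr_gt0 ?mulr_gt0.
  apply: le_trans (ler_wpM2l (ltW tau0) den_le) _.
  rewrite /tau le_eqVlt; apply/orP; left; apply/eqP; field.
  by rewrite !gt_eqF.
have tau0 : 0 < tau by rewrite divr_gt0 ?oppr_gt0 ?mulr_gt0.
have [|acc t'0 le'] := IH.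
  by rewrite (lt_le_trans tau0)// (le_trans (ltW itt)).
split=> //; move: le'; rewrite (min_r tau_le) => le'.
by rewrite ge_min le' orbT.
Qed.

Lemma dot_oppZr (R : realType) (n : nat) (k : R) (u v : 'rV[R]_n) :
  dot u (- (k *: v)) = - (k * dot u v).
Proof. by rewrite /dot linearN /= linearZ /= mulmxN -scalemxAr !mxE. Qed.

Lemma dot_oppZ (R : realType) (n : nat) (k : R) (v : 'rV[R]_n) :
  dot (- (k *: v)) (- (k *: v)) = k ^+ 2 * dot v v.
Proof.
by rewrite dot_oppZr /dot mulNmx -scalemxAl !mxE mulrN opprK mulrA expr2.
Qed.

(** The bound 1 / (2 K lambda) of the line search becomes uniform because K is
    a bound over a single ball: one containing the level set, with its radius
    enlarged by the longest possible search direction, L times a bound for the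
    gradient on the smaller ball. *)
Lemma accepted_step_lower_bound (R : realType) (m n : nat)
    (F : 'rV[R]_n -> 'rV[R]_m) (x0 : 'rV[R]_n) (gamma L : R) :
  C2 F -> bounded_set (level_set (objective F) x0) -> gamma < 1 -> 0 < L ->
  exists2 tau, 0 < tau & forall x lambda C t,
    level_set (objective F) x0 x -> 0 < lambda <= L -> objective F x <= C ->
    grad (objective F) x != 0 ->
    line_search (objective F) x (- (lambda *: grad (objective F) x))
      C gamma 1 t ->
    acceptable (objective F) x (- (lambda *: grad (objective F) x))
      C gamma t /\ tau <= t.
Proof.
move=> hF [r [_ hr]] g1 L0; set f := objective F in hr *.
have [df cf] : coordwise_C1 f := objective_coordwise_C1 hF.
have dcf j := grad_objective_coordwise_C1 j hF.
(* The bound hr holds only for radii strictly above r. *)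
pose r1 := r + 1.
have levr x : level_set f x0 x -> `|x| <= r1 by apply: hr; rewrite ltrDl.
have [G G0 hG] := continuous_bounded_ball r1 cf.
pose r2 := r1 + L * G.
have [M M0 hM] := continuous_bounded_ball
  (p := fun jl : 'I_n * 'I_n => fun x => grad (fun y => grad f y 0 jl.1) x 0 jl.2)
  r2 (fun jl => (dcf jl.1).2 jl.2).
(* The 1 keeps K positive when n = 0. *)
pose K := n%:R ^+ 2 * M + 1.
have K0 : 0 < K by rewrite ltr_wpDl// mulr_ge0 ?sqr_ge0// ltW.
exists (Num.min 1 (1 / (2 * K * L))).
  by rewrite lt_min ltr01 divr_gt0// !mulr_gt0.
move=> x lambda C t lx /andP[l0 lL] fC gn0 ls.
set d := - _ in ls *.
have xr := levr _ lx.
have gd : dot (grad f x) d = - (lambda * dot (grad f x) (grad f x)) by exact: dot_oppZr.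
have dd : dot d d = lambda ^+ 2 * dot (grad f x) (grad f x) by exact: dot_oppZ.
have gg0 := dot_gt0 gn0.
have dG : `|d| <= L * G.
  rewrite normrN normrZ gtr0_norm// ler_pM ?(ltW l0)//.
  by apply: normr_rV_le (ltW G0) _ => j; exact: hG.
have hK s : 0 <= s <= 1 ->
    f (x + s *: d) - f x - s * dot (grad f x) d <= K * s ^+ 2 * dot d d.
  move=> /andP[s0 s1].
  apply: le_trans (descent_ball (r := r2) (M := M) df _ _ s0 _ _) _.
  - by move=> j y; have [] := dcf j.
  - by move=> j l y; exact: (hM (j, l)).
  - by rewrite (le_trans xr)// lerDl mulr_ge0 ?ltW.
  - rewrite (le_trans (ler_normD _ _))// lerD// normrZ ger0_norm//.
    by rewrite (le_trans _ dG)// ler_piMl.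
  - by rewrite ler_wpM2r ?dot_ge0// ler_wpM2r ?sqr_ge0// lerDl.
have [||//|acc _ le'] := line_search_bound fC g1 K0 _ _ hK ls.
- by rewrite gd oppr_lt0 mulr_gt0.
- by rewrite dd mulr_gt0// exprn_gt0.
- by rewrite ltr01 lexx.
split=> //; apply: le_trans le'; rewrite le_min !ge_min lexx /=.
apply/orP; right.
have -> : - dot (grad f x) d / (2 * K * dot d d) = 1 / (2 * K * lambda).
  by rewrite gd dd; field; rewrite !gt_eqF.
by rewrite !div1r lef_pV2 ?posrE ?mulr_gt0// ler_pM2l// mulr_gt0.
Qed.

(** * Nonmonotone averages and their limits *)

(** C' is the average of Cv and fv with weights e Qv and 1: it lies above the
    smaller value fv, and it retains the share 1 / Q' of the decrease a. *)
Lemma nonmonotone_average_bounds (R : realType) (fv Cv Qv e a : R) :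
  0 <= e -> 1 <= Qv -> 0 <= a -> fv <= Cv - a ->
  let Q' := e * Qv + 1 in
  let C' := (e * Qv * Cv + fv) / Q' in
  fv <= C' <= Cv - a / Q'.
Proof.
move=> e0 Q1 a0 hf /=.
have eQ0 : 0 <= e * Qv by rewrite mulr_ge0// (le_trans ler01).
have Q'0 : 0 < e * Qv + 1 by rewrite ltr_wpDl.
apply/andP; split.
- rewrite ler_pdivlMr//.
  have : 0 <= e * Qv * (Cv - fv) by rewrite mulr_ge0// subr_ge0 (le_trans hf)// gerBl.
  lra.
- rewrite ler_pdivrMr// mulrBl divfK ?gt_eqF//; lra.
Qed.

(** If G stayed above e from N on, C would lose at least
    delta e / (k + 2) at each step k >= N; being nonnegative, C would bound the
    harmonic series. *)
Lemma harmonic_decrease_small (R : realType) (C G Q : nat -> R) (delta : R) :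
  0 < delta -> (forall k, 0 <= C k) ->
  (forall k, 0 < Q k <= k.+1%:R) ->
  (forall k, C k.+1 <= C k - delta * G k / Q k.+1) ->
  forall (e : R) (N : nat), 0 < e -> exists2 k, (N <= k)%N & G k < e.
Proof.
move=> d0 C0 hQ hC e N e0; apply: contrapT => hN.
have hG k : (N <= k)%N -> e <= G k.
  by move=> Nk; rewrite leNgt; apply/negP => Gk; apply: hN; exists k.
have de0 : 0 < delta * e by rewrite mulr_gt0.
apply: (@dvg_harmonic R).
have ndH : nondecreasing_seq (series (@harmonic R)).
  by apply/nondecreasing_seqP => i; rewrite seriesSr lerDl harmonic_ge0.
have step p : series (@harmonic R) (N.+1 + p)%N <=
    series (@harmonic R) N.+1 + (C N - C (N + p)%N) / (delta * e).
  elim: p => [|p IH]; first by rewrite !addn0 subrr mul0r addr0.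
  have loss : harmonic (N.+1 + p)%N <= (C (N + p)%N - C (N + p).+1) / (delta * e).
    have /andP[Q0 Qk] := hQ (N + p).+1.
    rewrite ler_pdivlMr// /harmonic /= addSn.
    have le1 : (N + p).+2%:R^-1 * (delta * e) <= delta * G (N + p)%N / Q (N + p).+1.
      rewrite mulrC ler_pM ?invr_ge0 ?ler0n ?(ltW de0)//.
        by rewrite ler_pM2l// hG// leq_addr.
      by rewrite lef_pV2 ?posrE.
    by apply: le_trans le1 _; have := hC (N + p)%N; lra.
  rewrite addnS seriesSr addnS.
  have -> : C N - C (N + p).+1 = C N - C (N + p)%N + (C (N + p)%N - C (N + p).+1).
    by rewrite addrA subrK.
  by rewrite mulrDl addrA lerD.
apply: nondecreasing_is_cvgn => //.
exists (series (@harmonic R) N.+1 + C N / (delta * e)) => _ [n _ <-].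
rewrite (le_trans (ndH _ _ (leq_addl N.+1 n)) _)// (le_trans (step n))// lerD2l.
by rewrite ler_pM2r ?invr_gt0// gerBl C0.
Qed.

(** C converges, so its decrements tend to 0, and they dominate G up to the
    factor q / delta. *)
Lemma bounded_weight_decrease_cvg0 (R : realType) (C G Q : nat -> R) (delta q : R) :
  0 < delta -> (forall k, 0 <= C k) -> (forall k, 0 <= G k) ->
  (forall k, 0 < Q k <= q) ->
  (forall k, C k.+1 <= C k - delta * G k / Q k.+1) ->
  G k @[k --> \oo] --> (0 : R).
Proof.
move=> d0 C0 G0 hQ hC.
have q0 : 0 < q by have /andP[/lt_le_trans] := hQ 0%N; apply.
have GC k : G k <= q / delta * (C k - C k.+1).
  have /andP[Q0 Qq] := hQ k.+1.
  have le1 : delta * G k / q <= delta * G k / Q k.+1.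
    by rewrite ler_wpM2l ?mulr_ge0 ?(ltW d0)// lef_pV2.
  have -> : G k = q / delta * (delta * G k / q) by field; rewrite !gt_eqF.
  rewrite ler_wpM2l ?divr_ge0 ?(ltW q0) ?(ltW d0)//.
  by apply: le_trans le1 _; have := hC k; lra.
have /cvg_ex[l Cl] : cvgn C.
  apply: nonincreasing_is_cvgn; last by exists 0 => _ [k _ <-]; exact: C0.
  apply/nonincreasing_seqP => k; rewrite (le_trans (hC k))// gerBl.
  have /andP[Q0 _] := hQ k.+1.
  by rewrite divr_ge0 ?mulr_ge0 ?G0// ltW.
apply: (squeeze_cvgr (f := fun=> 0) (h := fun k => q / delta * (C k - C k.+1))).
- by near=> k; rewrite G0 GC.
- exact: cvg_cst.
- rewrite -(mulr0 (q / delta)) -(subrr l); apply: cvgMr; apply: cvgB => //.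
  by rewrite cvg_shiftS.
Unshelve. all: by end_near. Qed.

Lemma limn_einf_eq0 (R : realType) (u : nat -> R) :
  (forall k, 0 <= u k) ->
  (forall (e : R) (N : nat), 0 < e -> exists2 k, (N <= k)%N & u k < e) ->
  limn_einf (fun k => (u k)%:E) = 0%E.
Proof.
move=> u0 hu; rewrite limn_einf_lim.
suff -> : einfs (fun k => (u k)%:E) = cst 0%E by exact: lim_cst.
apply/funext => N; apply/eqP; rewrite eq_le; apply/andP; split.
- apply/lee_addgt0Pr => e e0; rewrite add0e.
  have [k Nk uk] := hu e N e0.
  by apply: ge_ereal_inf; exists (u k)%:E; [exists k|rewrite lee_fin ltW].
- by apply: le_ereal_inf_tmp => _ [k _ <-]; rewrite lee_fin.
Qed.

Lemma averaging_weight_le (R : realType) (eta Q : nat -> R) :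
  Q 0%N = 1 -> (forall k, 0 <= eta k <= 1) ->
  (forall k, Q k.+1 = eta k * Q k + 1) -> forall k, 1 <= Q k <= k.+1%:R.
Proof.
move=> Q0 heta hQ; elim=> [|k /andP[Q1 Qk]]; first by rewrite Q0 lexx.
have /andP[e0 e1] := heta k.
rewrite hQ lerDr mulr_ge0 ?(le_trans ler01 Q1)//= -[in leRHS]natr1 lerD2r.
by rewrite (le_trans _ Qk)// ler_piMl// (le_trans ler01).
Qed.

(** The bound (1 - e)^-1 is the fixed point of q |-> e q + 1. *)
Lemma geometric_weight_le (R : realType) (eta Q : nat -> R) (e : R) :
  e < 1 -> Q 0%N = 1 -> (forall k, 0 <= eta k <= e) ->
  (forall k, Q k.+1 = eta k * Q k + 1) -> forall k, 0 <= Q k <= (1 - e)^-1.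
Proof.
move=> e1 Q0 heta hQ.
have e0 : 0 <= e by have /andP[/le_trans] := heta 0%N; apply.
have ie : 1 <= (1 - e)^-1 by rewrite invf_ge1 ?subr_gt0// gerBl.
elim=> [|k /andP[Qk0 Qk]]; first by rewrite Q0 ler01.
have /andP[h0 h1] := heta k.
rewrite hQ addr_ge0 ?mulr_ge0//=.
have -> : (1 - e)^-1 = e * (1 - e)^-1 + 1 by field; rewrite gt_eqF ?subr_gt0.
by rewrite lerD2r ler_pM.
Qed.

(** * Convergence *)

Theorem theorem1 (R : realType) (m n : nat) (hmn : (n <= m)%N)
    (F : 'rV[R]_n -> 'rV[R]_m) (hF : C2 F)
    (lambda_min lambda_max gamma eta_min eta_max beta : R)
    (hlmin : 0 < lambda_min) (hlmax : lambda_min <= lambda_max)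
    (hgamma : 0 < gamma < 1)
    (hetamin : 0 <= eta_min) (heta : eta_min <= eta_max) (hetamax : eta_max <= 1)
    (hbeta : 0 < beta)
    (x0 : 'rV[R]_n)
    (h1 : bounded_set (level_set (objective F) x0))
    (h2a : exists N : set 'rV[R]_n,
       [/\ open N, level_set (objective F) x0 `<=` N & C1_on N (objective F)])
    (h2b : exists K : R, forall x y : 'rV[R]_n,
       level_set (objective F) x0 x -> level_set (objective F) x0 y ->
       opnorm (Jac F x - Jac F y) <= K * enorm (x - y))
    (c : stepsize_choice)
    (x : nat -> 'rV[R]_n) (t lambda alpha eta C Q : nat -> R)
    (hrun : SSGM_run F c lambda_min lambda_max gamma eta_min eta_max beta x0
              x t lambda alpha eta C Q) :
  [/\ forall k : nat, level_set (objective F) x0 (x k),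
      limn_einf (fun k : nat => (enorm (grad (objective F) (x k)))%:E) = 0%E
    & eta_max < 1 ->
      enorm (grad (objective F) (x k)) @[k --> \oo] --> (0 : R)].
Proof.
case: hrun => hx0 hC0 hQ0 hl0 _ hg hls hx _ _ hl heta_k hQ _ hC.
have /andP[gam0 gam1] := hgamma.
set f := objective F in hC0 hC hls hg hx *.
pose G k := dot (grad f (x k)) (grad f (x k)).
have G0 k : 0 <= G k by exact: dot_ge0.
have eta01 k : 0 <= eta k <= 1.
  by have /andP[h h'] := heta_k k; rewrite (le_trans hetamin h) (le_trans h').
have hQk := averaging_weight_le hQ0 eta01 hQ.
have lb k : Num.min 1 lambda_min <= lambda k <= Num.max 1 lambda_max.
  case: k => [|k]; first by rewrite hl0 ge_min le_max lexx.
  rewrite hl; apply/andP; split.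
    apply: (@le_trans _ _ lambda_min); first by rewrite ge_min lexx orbT.
    by rewrite le_min le_max lexx hlmax orbT.
  by rewrite le_max !ge_min lexx !orbT.
set lm := Num.min 1 lambda_min in lb; set L := Num.max 1 lambda_max in lb.
have lm0 : 0 < lm by rewrite lt_min ltr01.
have L0 : 0 < L by rewrite lt_max ltr01.
have [tau tau0 htau] := accepted_step_lower_bound hF h1 gam1 L0.
pose delta := gamma * tau * lm.
have delta0 : 0 < delta by rewrite !mulr_gt0.
have decr k : level_set f x0 (x k) -> f (x k) <= C k ->
    f (x k.+1) <= C k - delta * G k.
  move=> lev fC; have /andP[lml lL] := lb k.
  have lk0 : 0 < lambda k by rewrite (lt_le_trans lm0).
  have lk : 0 < lambda k <= L by rewrite lk0.
  have [acc tt] := htau _ _ _ _ lev lk fC (hg k) (hls k).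
  move: acc; rewrite /acceptable -hx dot_oppZr -/(G k) => /le_trans; apply.
  rewrite lerD2l mulrN lerN2 mulrA ler_wpM2r// /delta.
  rewrite ler_pM ?mulr_ge0 ?(ltW gam0) ?(ltW tau0) ?(ltW lm0)//.
  by rewrite ler_pM2l.
have inv k :
    [/\ f (x k) <= C k, C k <= f x0 & C k.+1 <= C k - delta * G k / Q k.+1].
  have next j : f (x j) <= C j -> C j <= f x0 ->
      f (x j.+1) <= C j.+1 /\ C j.+1 <= C j - delta * G j / Q j.+1.
    move=> fC Cf; have /andP[ej0 _] := eta01 j; have /andP[Q1 _] := hQk j.
    have a0 : 0 <= delta * G j by rewrite mulr_ge0// ltW.
    have lev : level_set f x0 (x j) by exact: le_trans Cf.
    have := nonmonotone_average_bounds ej0 Q1 a0 (decr j lev fC).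
    by rewrite /= -hQ -hC => /andP[].
  have [fC Cf] : f (x k) <= C k /\ C k <= f x0.
    elim: k => [|k [fC Cf]]; first by rewrite hx0 hC0.
    have [fC' Cdec] := next k fC Cf; split=> //.
    rewrite (le_trans Cdec)// (le_trans _ Cf)// gerBl divr_ge0//.
      by rewrite mulr_ge0// ltW.
    by have /andP[/(le_trans ler01)] := hQk k.+1.
  by have [_ ?] := next k fC Cf.
have C_ge0 k : 0 <= C k.
  have [fC _ _] := inv k; apply: le_trans fC.
  by rewrite /f /objective mulr_ge0 ?sqr_ge0.
have dec k : C k.+1 <= C k - delta * G k / Q k.+1 by have [] := inv k.
split.
- by move=> k; have [fC Cf _] := inv k; exact: le_trans Cf.
- apply: limn_einf_eq0 => [k|e N e0]; first exact: sqrtr_ge0.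
  have Qk k : 0 < Q k <= k.+1%:R.
    by have /andP[/(lt_le_trans ltr01) -> ->] := hQk k.
  have e20 : 0 < e ^+ 2 by rewrite exprn_gt0.
  have [k Nk Gk] := harmonic_decrease_small delta0 C_ge0 Qk dec N e20.
  by exists k => //; rewrite /enorm -(gtr0_norm e0) -sqrtr_sqr ltr_sqrt.
- move=> eta1.
  have eta_le k : 0 <= eta k <= eta_max.
    by have /andP[h ->] := heta_k k; rewrite (le_trans hetamin h).
  have hQb := geometric_weight_le eta1 hQ0 eta_le hQ.
  have Qq k : 0 < Q k <= (1 - eta_max)^-1.
    have /andP[_ ->] := hQb k.
    by have /andP[/(lt_le_trans ltr01) -> _] := hQk k.
  have Gcvg := bounded_weight_decrease_cvg0 delta0 C_ge0 G0 Qq dec.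
  rewrite -[X in _ --> X](@sqrtr0 R).
  apply: (cvg_comp G (@Num.sqrt R) Gcvg).
  exact: sqrt_continuous.
Qed.
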